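(* There exists an absolute constant $c_1>0$ with the following property. Let $3=p_1<p_2<\cdots$ be the increasing sequence of odd primes, and let $(\varepsilon_i)_{i\ge1}$ be any sequence with $\varepsilon_i\in\{0,1\}$. Then for every sufficiently large real $x$ there exists a positive integer $n<x$ such that $$e_{p_i}(n)\equiv\varepsilon_i\pmod 2\quad\text{for all } i=1,\dots,k(x),\qquad\text{where } k(x):=\Bigl\lfloor c_1\Bigl(\frac{\log x}{(\log\log x)^6}\Bigr)^{1/9}\Bigr\rfloor .$$
   Context: For a prime $p$ and a non-negative integer $n$, $e_p(n)$ denotes the exponent of $p$ in the prime factorization of $n!$. *)

(* Defs.v *)
From Stdlib Require Import Reals.
From mathcomp Require Import all_boot.

Set Implicit Arguments.
Unset Strict Implicit.
Unset Printing Implicit Defensive.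

Lemma next_prime_ex (m : nat) : exists p, (m < p) && prime p.
Proof. case: (prime_above m) => p Hp Hpr; exists p; by rewrite Hp Hpr. Qed.

Definition next_prime (m : nat) : nat := ex_minn (next_prime_ex m).

(* nth_prime 0 = 2, nth_prime 1 = 3, nth_prime 2 = 5, ...
   Hence, for i >= 1, nth_prime i is the i-th odd prime p_i of the paper
   (p_1 = 3 < p_2 < ...). *)
Fixpoint nth_prime (i : nat) : nat :=
  match i with
  | 0 => 2
  | i'.+1 => next_prime (nth_prime i')
  end.

Definition e_p (p n : nat) : nat := logn p n`!.

Definition kfun (c1 x : R) : Z :=
  Int_part (Rmult c1 (Rpower (Rdiv (ln x) (pow (ln (ln x)) 6)) (Rdiv 1 9))).

(* Main.v *)
Require Import Defs.
From Stdlib Require Import Reals ZArith.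
From mathcomp Require Import all_boot all_order all_algebra.
From Stdlib Require Import Lra Lia.

(* For an odd prime p, the exponent e_p(n) has the parity of the sum of the
   base-p digits of n in odd positions.  Take n = m + h with m running over the
   residues modulo N = prod p_i^(2T) and 0 <= h < H.  By the Chinese remainder
   theorem the autocorrelations (over m) of the k parity signs factor over the
   primes, and for each single prime the autocorrelation at shift d contracts
   digit by digit: on average over d < p^(2t) it is at most (23/27)^t.  Hence
   the number of pairs (h, h') with equal parity vectors is, on average over m,
   so close to H^2 / 2^k that for some m every vector of {0,1}^k is attained.
   Addition of h does not carry past p_i^(2T) for a positive proportion of m,
   so the digits beyond that point only translate the target vector.
   As t = O(k) suffices and p_k <= 2^(4k^2), this gives n <= 2^(O(k^7)). *)

Set Implicit Arguments.
Unset Strict Implicit.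
Unset Printing Implicit Defensive.

(** * Growth of [kfun] against powers of two, over the Stdlib reals *)

Section RealBounds.
Local Open Scope R_scope.

Lemma INR_expn a b : INR (a ^ b)%N = INR a ^ b.
Proof. by elim: b => [|b IH]; rewrite ?expn0 // expnS mulnE mult_INR IH. Qed.

Lemma INR_expn2_le_exp n : INR (2 ^ n)%N <= exp (INR n).
Proof.
elim: n => [|n IH]; first by rewrite exp_0; right.
rewrite expnS mulnE mult_INR (S_INR n) exp_plus [_ * exp 1]Rmult_comm.
apply: Rmult_le_compat => //; try exact: pos_INR.
by have := exp_ineq1_le 1; rewrite /INR; lra.
Qed.

Lemma le_ln_of_exp_le a b : exp a <= b -> a <= ln b.
Proof.
case=> [lt|<-]; last by rewrite ln_exp; right.
by left; rewrite -(ln_exp a); apply: ln_increasing => //; apply: exp_pos.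
Qed.

(** Once [ln x] is at least 3, the divisor [ln (ln x) ^ 6] is at least 1 and dropping it only
    enlarges the bound. *)
Lemma kfun_le x : 3 <= ln x ->
  INR (Z.to_nat (kfun 1 x)) <= Rpower (ln x) (1 / 9).
Proof.
move=> l3; have y0 : 0 < Rpower (ln x) (1 / 9) by apply: exp_pos.
have [K0|K0] := Z_le_gt_dec (kfun 1 x) 0.
  by rewrite (_ : Z.to_nat _ = O) /=; [lra|lia].
rewrite INR_IZR_INZ Z2Nat.id; last by lia.
apply: Rle_trans (proj1 (base_Int_part _)) _; rewrite Rmult_1_l.
have ll1 : 1 <= ln (ln x) by apply/le_ln_of_exp_le/(Rle_trans _ _ _ exp_le_3).
have ll6 : 1 <= ln (ln x) ^ 6 by apply: pow_R1_Rle.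
apply: Rle_Rpower_l; first by lra.
split; first by apply: Rdiv_lt_0_compat; lra.
apply: (Rmult_le_reg_r (ln (ln x) ^ 6)); first by lra.
by rewrite /Rdiv Rmult_assoc Rinv_l; [nra|lra].
Qed.

(** With y the ninth root of [ln x], the exponent is O(y^7) while x = exp (y^9): the gap between 7
    and 9 absorbs every constant. *)
Lemma kfun_size_bound C : exists X, forall x, X <= x -> forall n,
  (n <= 2 ^ (C * (Z.to_nat (kfun 1 x)).+1 ^ 7))%N -> INR n < x.
Proof.
(* 128 = 2^7 comes from k + 1 <= 2y; the 3 yields the hypothesis of [kfun_le] and strictness at the
   end. *)
pose Y := 128 * INR C + 3.
have C0 := pos_INR C.
have Y3 : 3 <= Y by rewrite /Y; lra.
exists (exp (Y ^ 9)) => x Xx n nb.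
have x0 : 0 < x by apply: Rlt_le_trans Xx; apply: exp_pos.
have lY : Y ^ 9 <= ln x by apply: le_ln_of_exp_le.
have YY9 : Y <= Y ^ 9 by rewrite -[X in X <= _]pow_1; apply: Rle_pow; [lra|lia].
have l0 : 0 < ln x by lra.
set k := Z.to_nat _ in nb; set y := Rpower (ln x) (1 / 9).
have y9 : y ^ 9 = ln x.
  rewrite -Rpower_pow; last exact: exp_pos.
  rewrite Rpower_mult (_ : 1 / 9 * INR 9 = 1) ?Rpower_1 //.
  by rewrite /INR; field.
have yY : Y <= y.
  have -> : Y = Rpower (Y ^ 9) (1 / 9).
    rewrite -Rpower_pow; last by lra.
    rewrite Rpower_mult (_ : INR 9 * (1 / 9) = 1) ?Rpower_1 //; first by lra.
    by rewrite /INR; field.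
  by apply: Rle_Rpower_l; [lra|split=> //; apply: pow_lt; lra].
have ky : INR k <= y by apply: kfun_le; lra.
rewrite -(exp_ln x) //.
apply: Rle_lt_trans (le_INR _ _ (leP nb)) _.
apply: Rle_lt_trans (INR_expn2_le_exp _) _; apply: exp_increasing.
rewrite mulnE mult_INR INR_expn -y9.
have k7 : INR k.+1 ^ 7 <= (2 * y) ^ 7.
  by apply: pow_incr; split; [exact: pos_INR|rewrite S_INR; lra].
apply: (Rle_lt_trans _ (INR C * (2 * y) ^ 7)); first exact: Rmult_le_compat_l.
have -> : INR C * (2 * y) ^ 7 = 128 * INR C * y ^ 7 by ring.
have -> : y ^ 9 = y ^ 2 * y ^ 7 by ring.
apply: Rmult_lt_compat_r; first by apply: pow_lt; lra.
by rewrite /Y in yY Y3; nra.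
Qed.
End RealBounds.

(* These shadow the tactics [ring] and [lra] used above on Stdlib reals. *)
From mathcomp Require Import zify ring lra.

Import Order.TTheory GRing.Theory Num.Theory.

(** * Sums over digits, periods and residue systems *)

Section Sums.
Local Open Scope ring_scope.

Lemma sum_digit (V : nmodType) (p n : nat) (F : nat -> V) :
  \sum_(0 <= m < n * p) F m
  = \sum_(0 <= b < n) \sum_(0 <= a < p) F (a + b * p)%N.
Proof.
rewrite big_nat_mul; apply: eq_bigr => b _.
by rewrite -[X in \sum_(X <= _ < _) _]add0n big_addn mulSn addnK.
Qed.

(** Models a carry: adding [v] to a last digit [a] carries for exactly [v] of the [p] digits. *)
Lemma sum_threshold (V : zmodType) (p v : nat) (x y : V) : (v <= p)%N ->
  \sum_(0 <= a < p) (if (a + v < p)%N then x else y) = x *+ (p - v) + y *+ v.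
Proof.
move=> vp; rewrite (@big_cat_nat _ _ _ (p - v)) ?leq_subr //=.
congr (_ + _).
  rewrite (eq_big_nat _ _ (F2 := fun=> x)); first by rewrite big_const_nat iter_addr_0 subn0.
  by move=> a /andP[_ ha]; rewrite ifT //; lia.
rewrite (eq_big_nat _ _ (F2 := fun=> y)).
  by rewrite big_const_nat iter_addr_0 subKn.
by move=> a /andP[ha _]; rewrite ifF //; lia.
Qed.

Lemma sum_shift (V : zmodType) (P h : nat) (g : nat -> V) :
  (forall n, g (n + P)%N = g n) ->
  \sum_(0 <= m < P) g (m + h)%N = \sum_(0 <= m < P) g m.
Proof.
move=> gP; elim: h => [|h IH]; first by under eq_bigr do rewrite addn0.
rewrite -{}IH; case: P gP => [|P] gP; first by rewrite !big_geq.
rewrite [LHS]big_nat_recr // [RHS]big_nat_recl //= addrC; congr (_ + _).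
  by rewrite -(gP (0 + h)%N); congr g; lia.
by apply: eq_bigr => i _; congr g; lia.
Qed.

Lemma periodic_mod (V : Type) (P : nat) (g : nat -> V) :
  (forall n, g (n + P)%N = g n) -> forall n, g (n %% P)%N = g n.
Proof.
move=> gP n; rewrite {2}(divn_eq n P) addnC.
by elim: (n %/ P)%N => [|b IH]; rewrite ?mul0n ?addn0 // mulSn addnCA addnC gP.
Qed.

Lemma periodic_muln (V : Type) (P c : nat) (g : nat -> V) :
  (forall n, g (n + P)%N = g n) -> forall n, g (n + c * P)%N = g n.
Proof. by move=> gP n; rewrite -(periodic_mod gP) addnC modnMDl periodic_mod. Qed.

(** Chinese remainder theorem: write m = a + bA with a < A. Then [f] sees only a, and for fixed a
    the map b -> a + bA permutes the residues modulo B. *)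
Lemma sum_coprime_mul (R : comPzRingType) (A B : nat) (f g : nat -> R) :
  coprime A B -> (forall n, f (n + A)%N = f n) -> (forall n, g (n + B)%N = g n) ->
  \sum_(0 <= m < A * B) f m * g m
  = (\sum_(0 <= m < A) f m) * (\sum_(0 <= m < B) g m).
Proof.
move=> cAB fA gB; case: B cAB gB => [|B] cAB gB.
  by rewrite muln0 [X in _ = _ * X]big_geq // mulr0 big_geq.
rewrite mulnC sum_digit exchange_big_nat /= mulr_suml; apply: eq_bigr => a _.
under eq_bigr do rewrite (periodic_muln _ fA).
rewrite -mulr_sumr; congr (_ * _).
rewrite !big_mkord.
pose s (b : 'I_B.+1) : 'I_B.+1 := inord ((a + b * A) %% B.+1).
have sE b : s b = ((a + b * A) %% B.+1)%N :> nat by rewrite inordK // ltn_pmod.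
have s_inj : injective s.
  move=> b c /(congr1 (@nat_of_ord _)); rewrite !sE => /eqP.
  rewrite eqn_modDl => e; apply: val_inj => /=.
  wlog le_bc : b c e / (b <= c)%N.
    by move=> W; case: (leqP b c) => [/W->//|/ltnW/W<-//]; rewrite eq_sym.
  move: e; rewrite eq_sym eqn_mod_dvd ?leq_mul2r ?le_bc ?orbT // -mulnBl.
  rewrite Gauss_dvdl 1?coprime_sym // => /dvdnP[[|j] e]; first by lia.
  by have := ltn_ord c; nia.
rewrite [RHS](reindex_inj s_inj) /=; apply: eq_bigr => b _.
by rewrite sE periodic_mod.
Qed.

Lemma sum_coprime_prod (R : comPzRingType) (I : eqType) (s : seq I)
    (P : I -> nat) (g : I -> nat -> R) :
  uniq s -> {in s &, forall i j, i != j -> coprime (P i) (P j)} ->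
  (forall i n, g i (n + P i)%N = g i n) ->
  \sum_(0 <= m < \prod_(i <- s) P i) \prod_(i <- s) g i m
  = \prod_(i <- s) \sum_(0 <= m < P i) g i m.
Proof.
move=> us cP gP; elim: s us cP => [|i s IH] /=.
  by move=> _ _; rewrite !big_nil big_nat1 big_nil.
move=> /andP[si us] cP; rewrite !big_cons.
under eq_bigr do rewrite big_cons.
rewrite sum_coprime_mul //.
- rewrite IH // => j l js ls; apply: cP; rewrite inE ?js ?ls orbT //.
- rewrite big_seq; apply: (big_ind (coprime (P i))) => [|x y cx cy|j js].
  + exact: coprimen1.
  + by rewrite coprimeMr cx.
  by apply: cP; rewrite ?inE ?eqxx ?js ?orbT //; apply: contraNneq si => ->.
- move=> n; rewrite [LHS]big_seq [RHS]big_seq; apply: eq_bigr => j js.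
  have /dvdnP[c ->] : (P j %| \prod_(j <- s) P j)%N.
    by rewrite (big_rem j) //= dvdn_mulr.
  exact: periodic_muln.
Qed.

Lemma sum_minn_double h :
  (\sum_(0 <= v < h.*2.+1) minn v (h.*2 - v) = h ^ 2)%N.
Proof.
elim: h => [|h IH]; first by rewrite big_nat1.
rewrite doubleS big_nat_recl // big_nat_recr //=.
rewrite (eq_big_nat _ _ (F2 := fun v => (minn v (h.*2 - v) + 1)%N)); last first.
  by move=> v hv; lia.
rewrite big_split /= IH big_const_nat iter_addn; lia.
Qed.
End Sums.

(** * Digit parities and the decay of their autocorrelations *)

Section Digits.
Local Open Scope ring_scope.

Variable R : realFieldType.

(* Parity of the sum of every other one of the lowest [T] base-[p] digits of
   [n]; [b] tells whether the lowest digit counts. *)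
Fixpoint dpar (p T : nat) (b : bool) (n : nat) : bool :=
  if T is T'.+1 then (b && odd (n %% p)) (+) dpar p T' (~~ b) (n %/ p)
  else false.

Definition dsign (p T : nat) (b : bool) (n : nat) : R := (-1) ^+ dpar p T b n.

Definition corr (p T : nat) (b : bool) (d : nat) : R :=
  (\sum_(0 <= m < p ^ T) dsign p T b m * dsign p T b (m + d)) / (p ^ T)%:R.

Lemma dpar_periodic p T b n : (0 < p)%N ->
  dpar p T b (n + p ^ T)%N = dpar p T b n.
Proof.
move=> p0; elim: T b n => //= T IH b n.
by rewrite expnSr addnC modnMDl divnMDl // addnC IH.
Qed.

Lemma dsign_periodic p T b n : (0 < p)%N ->
  dsign p T b (n + p ^ T)%N = dsign p T b n.
Proof. by move=> p0; rewrite /dsign dpar_periodic. Qed.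

Lemma dsignS p T b n :
  dsign p T.+1 b n = (-1) ^+ (b && odd (n %% p)) * dsign p T (~~ b) (n %/ p).
Proof. by rewrite /dsign /= signr_addb. Qed.

(** Split off the last digit of m. Without a carry the shift of the other digits is [w]; a carry
    raises it to [w.+1] and subtracts the odd number [p] from the last digit, which flips its
    parity. Allowing [v = p] lets the shifts d and d + 1 share one quotient [w]. *)
Lemma corrS p T b v w : odd p -> (v <= p)%N ->
  corr p T.+1 b (v + w * p)
  = (-1) ^+ (b && odd v) * ((p - v)%:R * corr p T (~~ b) w
      + (-1) ^+ b * (v%:R * corr p T (~~ b) w.+1)) / p%:R.
Proof.
move=> op vp; have p0 : (0 < p)%N by case: p op {vp}.
have pn0 : p%:R != 0 :> R by rewrite pnatr_eq0 -lt0n.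
have pT0 : (p ^ T)%:R != 0 :> R by rewrite pnatr_eq0 expn_eq0; lia.
rewrite /corr expnSr sum_digit exchange_big_nat /=.
pose S w := \sum_(0 <= m < p ^ T) dsign p T (~~ b) m * dsign p T (~~ b) (m + w).
rewrite (eq_big_nat _ _ (F2 := fun a => if (a + v < p)%N
   then (-1) ^+ (b && odd v) * S w
   else (-1) ^+ (b && odd v) * (-1) ^+ b * S w.+1)).
  rewrite sum_threshold // -/(S w) -/(S w.+1) natrM.
  move: (S w) (S w.+1) ((-1) ^+ (b && odd v)) ((-1) ^+ b) => x y e e'.
  rewrite -(mulr_natl (e * x)) -(mulr_natl (e * e' * y)).
  move: (p - v)%N => u; move: ((p ^ T)%:R : R) (u%:R : R) (p%:R : R) (v%:R : R) pn0 pT0.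
  move=> A B C D hC hA.
  by field; rewrite hC.
move=> a /andP[_ ap].
have E j : (a + j * p + (v + w * p) = (a + v) + (j + w) * p)%N by lia.
have dE x j : ((x + j * p) %% p = x %% p)%N by rewrite addnC modnMDl.
have qE x j : ((x + j * p) %/ p = x %/ p + j)%N by rewrite addnC divnMDl // addnC.
case: ifP => av; rewrite mulr_sumr; apply: eq_bigr => j _; rewrite E !dsignS !dE !qE.
  rewrite !divn_small // !modn_small // !add0n mulrACA; congr (_ * _).
  by case: b {S} => /=; rewrite ?mulr1 // -signr_addb oddD addbA addbb.
have -> : (a + v = (a + v - p) + 1 * p)%N by lia.
have lt : (a + v - p < p)%N by lia.
rewrite dE qE !divn_small // !modn_small // !add0n add1n -addnS mulrACA.
congr (_ * _).
case: b {S} => /=; rewrite ?mulr1 // -signr_addb oddB ?oddD ?op; last by lia.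
by case: (odd a); case: (odd v); rewrite /= ?expr0 ?expr1 ?mulr1 ?mul1r ?mulN1r ?opprK.
Qed.

Lemma corr0 p b d : corr p 0 b d = 1.
Proof. by rewrite /corr expn0 big_nat1 /dsign /= expr0 mulr1 divr1. Qed.

Lemma corr_le1 p T b d : odd p -> `|corr p T b d| <= 1.
Proof.
move=> op; have p0 : (0 < p)%N by case: p op.
elim: T b d => [|T IH] b d; first by rewrite corr0 normr1.
have vp := ltn_pmod d p0.
rewrite (divn_eq d p) addnC corrS ?(ltnW vp) // normrM normrM normr_sign mul1r.
rewrite normfV normr_nat ler_pdivrMr ?ltr0n // mul1r.
rewrite (le_trans (ler_normD _ _)) // (normrM ((-1) ^+ b)) normr_sign mul1r.
rewrite !(normrM _%:R) !normr_nat.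
rewrite natrB ?(ltnW vp) //.
have V0 : 0 <= (d %% p)%:R :> R by [].
have VP : (d %% p)%:R <= p%:R :> R by rewrite ler_nat ltnW.
have := ler_wpM2l V0 (IH (~~ b) (d %/ p).+1).
have := ler_wpM2l (_ : 0 <= p%:R - (d %% p)%:R :> R) (IH (~~ b) (d %/ p)%N).
by rewrite subr_ge0 => /(_ VP) ? ?; lra.
Qed.

(** Factor gained from two digits when the lower digit of the shift is [v]. Taking [p.-1 - v]
    instead of [p - v] makes it valid for both [v] and [v.+1]. *)
Definition contraction (p v : nat) : R :=
  1 - 2 * (p%:R - 1) * (minn v (p.-1 - v))%:R / p%:R ^+ 2.

(** Each round consumes two digits of the shift, as only every other digit counts; the upper one
    does not affect the factor. *)
Fixpoint corr_bound (p t d : nat) : R :=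
  if t is t'.+1 then contraction p (d %% p) * corr_bound p t' (d %/ p %/ p)
  else 1.

(* With [b0], [b1] the values of the sign-digit correlation at consecutive
   arguments, [b0 + b1] is small since the two are nearly opposite. *)
Lemma interpolation_contraction (p u v w : nat) (x y M b0 b1 : R) :
  (0 < p)%N -> (u < p)%N -> (w <= v)%N -> (v + w <= p)%N ->
  `|x| <= M -> `|y| <= M ->
  b0 = ((p - u)%:R * x - u%:R * y) / p%:R ->
  b1 = - ((p - u.+1)%:R * x - u.+1%:R * y) / p%:R ->
  `|((p - v)%:R * b0 + v%:R * b1) / p%:R|
    <= (1 - 2 * (p%:R - 1) * w%:R / p%:R ^+ 2) * M.
Proof.
move=> p0 up wv vwp xM yM -> ->.
have P0 : 0 < p%:R :> R by rewrite ltr0n.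
have up' := ltnW up; have vp : (v <= p)%N by lia.
rewrite !natrB // => {up' vp}.
have : u%:R + 1 <= p%:R :> R by rewrite natr1 ler_nat.
have : w%:R <= v%:R :> R by rewrite ler_nat.
have : v%:R + w%:R <= p%:R :> R by rewrite -natrD ler_nat.
have : 0 <= u%:R :> R by []. have : 0 <= w%:R :> R by [].
have : 1 <= p%:R :> R by rewrite ler1n.
rewrite -[u.+1%:R]natr1.
move: (p%:R : R) (u%:R : R) (v%:R : R) (w%:R : R) P0 => {p u v w p0 up wv vwp} p u v w.
move=> p0 p1 w0 u0 vwp wv up.
set a := (p - v) * (p - u) - v * (p - (u + 1)).
set b := v * (u + 1) - (p - v) * u.
have -> : ((p - v) * (((p - u) * x - u * y) / p)
   + v * (- ((p - (u + 1)) * x - (u + 1) * y) / p)) / p = (a * x + b * y) / p ^+ 2.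
  by rewrite /a /b; field; rewrite gt_eqF.
have -> : (1 - 2 * (p - 1) * w / p ^+ 2) * M = (p ^+ 2 - 2 * (p - 1) * w) * M / p ^+ 2.
  by field; rewrite gt_eqF.
rewrite normrM normfV normrX (gtr0_norm p0) ler_pM2r ?invr_gt0 ?exprn_gt0 //.
(* Rewrite a x + b y in terms of x + y and x - y: here a - b = p(p - 2v) and a + b = (p - 2u)(p -
   2v) + 2v are both at most K in absolute value, and |x + y| + |x - y| is twice the larger of |x|
   and |y|. *)
set K := p ^+ 2 - _.
have h1 : `|a - b| <= K.
  by rewrite ler_norml /a /b /K; apply/andP; split; nra.
have h2 : `|a + b| <= K.
  have [hv|hv] := leP (2 * v) p; rewrite ler_norml /a /b /K; apply/andP; split.
  - by nra.
  - by nra.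
  - by nra.
  - by nra.
have h3 : `|x + y| + `|x - y| <= 2 * M.
  move: xM yM; rewrite !ler_norml => /andP[? ?] /andP[? ?].
  by case: (ger0P (x + y)) => ?; case: (ger0P (x - y)) => ?; lra.
have -> : a * x + b * y = 2^-1 * ((a + b) * (x + y) + (a - b) * (x - y)) by field.
rewrite normrM ger0_norm ?invr_ge0 // mulrC ler_pdivrMr //.
rewrite (le_trans (ler_normD _ _)) // !normrM.
have K0 : 0 <= K := le_trans (normr_ge0 _) h1.
apply: (le_trans (y := K * (`|x + y| + `|x - y|))).
  by rewrite mulrDr lerD // ler_wpM2r.
by rewrite -mulrA ler_wpM2l // mulrC.
Qed.

(** Two uses of [corrS]: the lower digit does not count, so it interpolates with plain weights
    between next digits [u] and [u.+1]; that digit counts, so the two values have opposite signs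
    [odd u] and [odd u.+1] and partly cancel. *)
Lemma corr_leS p T u v w s (M : R) : odd p -> (u < p)%N ->
  (w <= v)%N -> (v + w <= p)%N ->
  `|corr p T false s| <= M -> `|corr p T false s.+1| <= M ->
  `|corr p T.+2 false (v + (u + s * p) * p)|
    <= (1 - 2 * (p%:R - 1) * w%:R / p%:R ^+ 2) * M.
Proof.
move=> op up wv vwp xM yM; have p0 : (0 < p)%N by exact: odd_gt0.
have vp : (v <= p)%N by lia.
have -> := @corrS p T.+1 false v (u + s * p) op vp.
have -> := @corrS p T true u s op (ltnW up).
have -> := @corrS p T true u.+1 s op up.
rewrite [~~ true]/= [odd u.+1]/= !andTb andFb signrN expr0 expr1.
set x := corr p T false s in xM *; set y := corr p T false s.+1 in yM *.
pose b0 := ((p - u)%:R * x - u%:R * y) / p%:R.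
pose b1 := - ((p - u.+1)%:R * x - u.+1%:R * y) / p%:R.
set X := (X in X / _).
have -> : X = (-1) ^+ odd u * ((p - v)%:R * b0 + v%:R * b1).
  by rewrite /X /b0 /b1; ring.
rewrite -[X in `|X|](mulrA ((-1) ^+ odd u)) normrM normr_sign mul1r.
by apply: (@interpolation_contraction p u v w x y M b0 b1).
Qed.

Lemma contraction_ge0 p v : (0 < p)%N -> 0 <= contraction p v.
Proof.
case: p => // p _; rewrite /contraction /=.
have -> : p.+1%:R - 1 = p%:R :> R by rewrite -[p.+1%:R]natr1 addrK.
rewrite subr_ge0 ler_pdivrMr ?exprn_gt0 ?ltr0n // mul1r -natrX -!natrM ler_nat.
by nia.
Qed.

(** The bounds at d and d + 1 are proved together because a carry turns the quotient [s] into
    [s.+1]. The [T] leftover digits are bounded trivially by 1. *)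
Lemma corr_boundP p t T d : odd p ->
  `|corr p (t.*2 + T) false d| <= corr_bound p t d
  /\ `|corr p (t.*2 + T) false d.+1| <= corr_bound p t d.
Proof.
move=> op; have p0 : (0 < p)%N by case: p op.
elim: t d => [|t IH] d /=; first by split; apply: corr_le1.
have [] := IH (d %/ p %/ p)%N; set s := (d %/ p %/ p)%N; set M := corr_bound p t s.
move=> xM yM; set v := (d %% p)%N; set u := (d %/ p %% p)%N.
have dE : d = (v + (u + s * p) * p)%N.
  by rewrite [LHS](divn_eq d p) [(d %/ p)%N in LHS](divn_eq (d %/ p) p) -/v -/u -/s; lia.
have vp : (v < p)%N by rewrite ltn_pmod.
have up : (u < p)%N by rewrite ltn_pmod.
rewrite addSn addSn; split.
  by rewrite [d in corr _ _ _ d]dE; apply: corr_leS => //; lia.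
have -> : d.+1 = (v.+1 + (u + s * p) * p)%N by rewrite {1}dE addSn.
by apply: corr_leS => //; lia.
Qed.

(** The sum equals p - (p - 1)^3 / (2 p^2), and p - 1 >= 2p/3 gives the constant 23/27, attained at
    p = 3. *)
Lemma sum_contraction p : odd p -> (2 < p)%N ->
  \sum_(0 <= v < p) contraction p v <= 23 / 27 * p%:R.
Proof.
move=> op p2; pose h := p./2.
have pE : p = h.*2.+1 by lia.
rewrite /contraction sumrB /= -mulr_suml -mulr_sumr -natr_sum.
have -> : (\sum_(0 <= v < p) minn v (p.-1 - v) = h ^ 2)%N.
  by rewrite pE sum_minn_double.
rewrite big_const_nat iter_addr_0 subn0.
have -> : (h ^ 2)%:R = ((p%:R - 1) / 2) ^+ 2 :> R.
  rewrite natrX; congr (_ ^+ 2); rewrite {1}pE -[h.*2.+1%:R]natr1 addrK -muln2 natrM.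
  by rewrite mulfK // pnatr_eq0.
have : 3 <= p%:R :> R by rewrite ler_nat.
move: (p%:R : R) => {op p2 pE h}q q3.
have q0 : 0 < q by lra.
rewrite lerBlDr -lerBlDl ler_pdivlMr ?exprn_gt0 //.
have : 2 / 3 * q <= q - 1 by lra.
move=> h23; have : (2 / 3 * q) ^+ 3 <= (q - 1) ^+ 3.
  by rewrite lerXn2r // nnegrE; lra.
by rewrite !exprS !expr0 => ?; lra.
Qed.

(** The bound is a product over digit pairs, so its sum over full digit ranges factors. The free
    multiple [s] later permits one range for all primes. *)
Lemma sum_corr_bound p t s : odd p -> (2 < p)%N ->
  \sum_(0 <= d < s * (p ^ 2) ^ t) corr_bound p t d
    <= (23 / 27) ^+ t * (s * (p ^ 2) ^ t)%:R.
Proof.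
move=> op p2; elim: t => [|t IH] /=.
  by rewrite expn0 muln1 expr0 mul1r big_const_nat iter_addr_0 subn0.
rewrite [(_ ^ t.+1)%N]expnSr mulnA expnS expn1 mulnA 2!sum_digit.
have p0 := odd_gt0 op.
rewrite (eq_bigr (fun b => p%:R * (\sum_(0 <= v < p) contraction p v) *
    corr_bound p t b)); last first.
  move=> b _; rewrite (eq_big_nat _ _ (F2 := fun=>
      (\sum_(0 <= v < p) contraction p v) * corr_bound p t b)).
    by rewrite big_const_nat iter_addr_0 subn0 -mulrA mulr_natl.
  move=> u /andP[_ up]; rewrite mulr_suml; apply: eq_big_nat => v /andP[_ vp] /=.
  have dE x j : (x < p)%N -> ((x + j * p) %% p = x)%N.
    by move=> xp; rewrite addnC modnMDl modn_small.
  have qE x j : (x < p)%N -> ((x + j * p) %/ p = j)%N.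
    by move=> xp; rewrite addnC divnMDl // divn_small ?addn0.
  by rewrite dE // !qE.
rewrite -mulr_sumr.
apply: le_trans (ler_pM _ _ (ler_wpM2l _ (sum_contraction op p2)) IH) _ => //.
- by rewrite mulr_ge0 // sumr_ge0 // => v _; apply: contraction_ge0.
- apply: sumr_ge0 => d _; elim: t d {IH} => //= t IH d.
  by rewrite mulr_ge0 // contraction_ge0.
by rewrite exprS !natrM le_eqVlt; apply/orP; left; apply/eqP; ring.
Qed.

Lemma corr_eq p T b h h' : (0 < p)%N -> (h <= h')%N ->
  (\sum_(0 <= m < p ^ T) dsign p T b (m + h) * dsign p T b (m + h')) / (p ^ T)%:R
  = corr p T b (h' - h).
Proof.
move=> p0 hh; congr (_ / _).
rewrite -(sum_shift h (g := fun m => dsign p T b m * dsign p T b (m + (h' - h)))).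
  by apply: eq_bigr => m _; rewrite -addnA subnKC.
by move=> n; rewrite addnAC !dsign_periodic.
Qed.

(** For fixed h, each distance occurs at most twice, once on either side. *)
Lemma sum_dist_le (H : nat) (g : nat -> R) : (forall d, 0 <= g d) ->
  \sum_(0 <= h < H) \sum_(0 <= h' < H) g ((h - h') + (h' - h))%N
    <= 2 * H%:R * \sum_(0 <= d < H) g d.
Proof.
move=> g0.
have mono a b : (a <= b)%N -> \sum_(0 <= d < a) g d <= \sum_(0 <= d < b) g d.
  by move=> ab; rewrite (big_cat_nat _ ab) //= lerDl sumr_ge0.
rewrite mulrAC mulr_natr.
have -> : (2 * \sum_(0 <= d < H) g d) *+ H
    = \sum_(0 <= h < H) (2 * \sum_(0 <= d < H) g d).
  by rewrite big_const_nat iter_addr_0 subn0.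
apply: ler_sum_nat => h /andP[_ hH].
rewrite (@big_cat_nat _ _ _ h.+1) //= mulr_natl mulr2n lerD //.
  rewrite big_nat_rev /= (eq_big_nat _ _ (F2 := g)) ?mono // => d /andP[_ dh].
  by congr g; lia.
rewrite -[h.+1 in leLHS]add0n big_addn.
apply: le_trans (mono (H - h.+1).+1 H _); last by lia.
rewrite big_nat_recl // (eq_big_nat _ _ (F2 := fun d => g d.+1)) ?lerDr //.
by move=> d _; congr g; lia.
Qed.

Lemma corr_mean p t T s (H := (s * (p ^ 2) ^ t)%N) : odd p -> (2 < p)%N ->
  \sum_(0 <= h < H) \sum_(0 <= h' < H)
    `|(\sum_(0 <= m < p ^ (t.*2 + T)) dsign p (t.*2 + T) false (m + h)
         * dsign p (t.*2 + T) false (m + h')) / (p ^ (t.*2 + T))%:R|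
  <= 2 * (23 / 27) ^+ t * H%:R ^+ 2.
Proof.
move=> op p2; have p0 := odd_gt0 op.
pose g d := `|corr p (t.*2 + T) false d|.
rewrite (eq_bigr (fun h => \sum_(0 <= h' < H) g ((h - h') + (h' - h))%N)); last first.
  move=> h _; apply: eq_bigr => h' _; rewrite /g; case: (leqP h h') => hh.
    by rewrite corr_eq // (eqP hh) add0n.
  rewrite (eqP (ltnW hh)) addn0 -(corr_eq _ _ p0 (ltnW hh)).
  by under eq_bigr do rewrite mulrC.
apply: le_trans (sum_dist_le _ _) _ => [d|]; first exact: normr_ge0.
have := ler_wpM2l (_ : 0 <= 2 * H%:R :> R)
  (le_trans (ler_sum _ (fun d _ => proj1 (corr_boundP t T d op))) (sum_corr_bound t s op p2)).
rewrite mulr_ge0 // => /(_ isT) /le_trans -> //.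
by rewrite -/H le_eqVlt; apply/orP; left; apply/eqP; ring.
Qed.
End Digits.

(** * Second moments and coverage of all parity vectors *)

Section SecondMoment.
Local Open Scope ring_scope.
Variable R : realFieldType.

Lemma prod1D_le (I : Type) (s : seq I) (x : I -> R) :
  (forall i, `|x i| <= 1) ->
  \prod_(i <- s) (1 + x i) <= 1 + 2 ^+ size s * \sum_(i <- s) `|x i|.
Proof.
move=> x1; have x1' i : 0 <= 1 + x i <= 2.
  by have := x1 i; rewrite ler_norml => /andP[? ?]; apply/andP; split; lra.
(* The two-sided bound on the product is what the induction needs. *)
suff : 0 <= \prod_(i <- s) (1 + x i) <= 2 ^+ size s
       /\ \prod_(i <- s) (1 + x i) <= 1 + 2 ^+ size s * \sum_(i <- s) `|x i|.
  by case.
elim: s => [|i s [/andP[h0 h1] h2]]; first by rewrite !big_nil /= expr0 mulr0 addr0 ler01 lexx.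
rewrite !big_cons /= exprS; have /andP[i0 i2] := x1' i.
split; first by rewrite mulr_ge0 //= ler_pM.
have := ler_norm (x i); have : 0 <= \sum_(j <- s) `|x j| by apply: sumr_ge0.
have := normr_ge0 (x i); have : 0 <= 2 ^+ size s :> R by apply: exprn_ge0.
move: (\prod_(j <- s) _) (\sum_(j <- s) _) (2 ^+ size s) (x i) `|x i| h0 h1 h2.
move=> p S e y z p0 pe pS e0 z0 S0 yz.
have := ler_wpM2r p0 yz; have := ler_wpM2l z0 pe.
by have := mulr_ge0 e0 S0; have := mulr_ge0 e0 z0; lra.
Qed.

Definition collisions (V : finType) (f : nat -> V) (H : nat) : R :=
  \sum_(0 <= h < H) \sum_(0 <= h' < H) (f h == f h')%:R.

(** An unnormalised variance over v of the number of h hitting v; the cross term collapses because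
    each h hits exactly one v. *)
Lemma collisions_variance (V : finType) (f : nat -> V) (H : nat) :
  \sum_v (#|V|%:R * (\sum_(0 <= h < H) (f h == v)%:R) - H%:R) ^+ 2
  = #|V|%:R * (#|V|%:R * collisions f H - H%:R ^+ 2) :> R.
Proof.
have sum1 h : \sum_v (f h == v)%:R = 1 :> R.
  rewrite (bigD1 (f h)) //= eqxx big1 ?addr0 // => v.
  by rewrite eq_sym => /negbTE->.
have sumc : \sum_v \sum_(0 <= h < H) (f h == v)%:R = H%:R :> R.
  rewrite exchange_big /= (eq_bigr (fun=> 1)) => [|h _]; last exact: sum1.
  by rewrite big_const_nat iter_addr_0 subn0.
have sumc2 : \sum_v (\sum_(0 <= h < H) (f h == v)%:R) ^+ 2 = collisions f H.
  under eq_bigr do rewrite expr2 mulr_suml.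
  rewrite exchange_big; apply: eq_bigr => h _ /=.
  under eq_bigr do rewrite mulr_sumr.
  rewrite exchange_big; apply: eq_bigr => h' _ /=.
  rewrite (bigD1 (f h)) //= eqxx mul1r big1 ?addr0 1?eq_sym // => v.
  by rewrite eq_sym => /negbTE->; rewrite mul0r.
under eq_bigr => v _.
  rewrite (_ : _ ^+ 2 = #|V|%:R ^+ 2 * (\sum_(0 <= h < H) (f h == v)%:R) ^+ 2
    - 2 * #|V|%:R * H%:R * (\sum_(0 <= h < H) (f h == v)%:R) + H%:R ^+ 2); last by ring.
  over.
rewrite big_split sumrB /= -!mulr_sumr sumc sumc2 sumr_const -mulr_natl.
by ring.
Qed.

Lemma collisions_ge (V : finType) (f : nat -> V) (H : nat) :
  0 <= #|V|%:R * collisions f H - H%:R ^+ 2.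
Proof.
have V0 : 0 < #|V|%:R :> R by rewrite ltr0n; apply/card_gt0P; exists (f 0%N).
rewrite -(pmulr_rge0 _ V0) -collisions_variance.
by apply: sumr_ge0 => v _; apply: sqr_ge0.
Qed.

(** A missed value alone contributes H^2 to the sum of squares in [collisions_variance]. *)
Lemma collisions_missed (V : finType) (f : nat -> V) (H : nat) (v : V) :
  (forall h, (h < H)%N -> f h != v) ->
  H%:R ^+ 2 <= #|V|%:R * (#|V|%:R * collisions f H - H%:R ^+ 2).
Proof.
move=> fv; rewrite -collisions_variance (bigD1 v) //=.
rewrite [\sum_(0 <= _ < _) _](eq_big_nat _ _ (F2 := fun=> 0)) => [|h /andP[_ hH]]; last first.
  by rewrite (negbTE (fv h hH)).
rewrite big1_eq mulr0 sub0r sqrrN lerDl.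
by apply: sumr_ge0 => w _; apply: sqr_ge0.
Qed.

(** If every m with room for H missed some vector, each would have a large collision excess, while
    the small autocorrelations make the total excess small. *)
Lemma patterns_covered (k H : nat) (P : 'I_k -> nat) (X : 'I_k -> nat -> bool)
    (delta : R) (chi := fun i n => (-1) ^+ X i n : R) :
  (0 < H)%N -> (forall i, 2 * H <= P i)%N ->
  (forall i j, i != j -> coprime (P i) (P j)) ->
  (forall i n, X i (n + P i)%N = X i n) ->
  (forall i, \sum_(0 <= h < H) \sum_(0 <= h' < H)
     `|(\sum_(0 <= m < P i) chi i (m + h)%N * chi i (m + h')%N) / (P i)%:R|
     <= delta * H%:R ^+ 2) ->
  8 ^+ k * k%:R * delta < 1 ->
  exists m, [/\ (m < \prod_i P i)%N, forall i, (m %% P i + H <= P i)%N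
    & forall v : 'I_k -> bool, exists2 h, (h < H)%N & forall i, X i (m + h)%N = v i].
Proof.
move=> H0 HP cP XP mean small.
pose N := (\prod_i P i)%N.
have P0 i : (0 < P i)%N by have := HP i; lia.
have N0 : 0 < N%:R :> R by rewrite ltr0n prodn_gt0.
pose good m := [forall i, m %% P i + H <= P i]%N.
pose pat m h := [ffun i => X i (m + h)%N].
pose hit m := [forall v : {ffun 'I_k -> bool}, [exists h : 'I_H, pat m h == v]].
case: (boolP [exists m : 'I_N, good m && hit m]) => [/existsP[m /andP[/forallP gm /forallP hm]]|].
  exists m; split=> // v; have /existsP[h /eqP E] := hm [ffun i => v i].
  by exists h => // i; move/ffunP/(_ i): E; rewrite !ffunE.
rewrite negb_exists => /forallP miss; exfalso.
pose K : R := #|{ffun 'I_k -> bool}|%:R.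
have KE : K = 2 ^+ k by rewrite /K card_ffun card_bool card_ord natrX.
(* Excess of collisions at m over the equidistributed value, scaled by 2^k. *)
pose D m : R := K * collisions (pat m) H - H%:R ^+ 2.
have D0 m : 0 <= D m by apply: collisions_ge.
have goodD m : (m < N)%N -> (good m)%:R * H%:R ^+ 2 <= K * D m.
  move=> mN; have := miss (Ordinal mN); rewrite negb_and /=.
  case: (good m) => /=; last by rewrite mul0r mulr_ge0 // /K.
  rewrite negb_forall mul1r => /existsP[v]; rewrite negb_exists => /forallP nv.
  by apply: (collisions_missed (v := v)) => h hH; apply: nv (Ordinal hH).
pose gam i h h' : R := (\sum_(0 <= m < P i) chi i (m + h)%N * chi i (m + h')%N) / (P i)%:R.
have chi1 i n : `|chi i n| = 1 by rewrite normr_sign.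
have gam1 i h h' : `|gam i h h'| <= 1.
  rewrite normrM normfV normr_nat ler_pdivrMr ?ltr0n // mul1r.
  rewrite (le_trans (ler_norm_sum _ _ _)) //.
  rewrite (eq_bigr (fun=> 1)) => [|m _]; last by rewrite normrM !chi1 mulr1.
  by rewrite big_const_nat iter_addr_0 subn0.
(* One plus a product of two signs is 2 if they agree and 0 otherwise. *)
have patE m h h' : K * (pat m h == pat m h')%:R
    = \prod_i (1 + chi i (m + h)%N * chi i (m + h')%N).
  case: eqP => [/ffunP E|/eqP E].
    rewrite mulr1 KE (eq_bigr (fun=> 2)) => [|i _].
      by rewrite prodr_const card_ord.
    by have := E i; rewrite /chi !ffunE => ->; rewrite -signr_addb addbb.
  have /existsP[i Ei] : [exists i, X i (m + h)%N != X i (m + h')%N].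
    apply: contraNT E; rewrite negb_exists => /forallP E.
    by apply/eqP/ffunP => i; rewrite !ffunE; apply/eqP; have := E i; rewrite negbK.
  rewrite (bigD1 i) //= /chi -signr_addb.
  by move: Ei; case: (X i (m + h)%N); case: (X i (m + h')%N) => //= _; rewrite expr1 subrr mul0r mulr0.
(* Coprime periods turn the average over m of a product into the product of the averages
   [1 + gam i h h']. *)
have sumD : \sum_(0 <= m < N) D m
    = N%:R * \sum_(0 <= h < H) \sum_(0 <= h' < H) (\prod_i (1 + gam i h h') - 1).
  rewrite sumrB big_const_nat iter_addr_0 subn0 -[_ *+ N]mulr_natl.
  under [\sum_(0 <= h < H) _]eq_bigr do rewrite sumrB big_const_nat iter_addr_0 subn0.
  rewrite sumrB big_const_nat iter_addr_0 subn0 -[H%:R *+ H]mulr_natr -expr2 mulrBr.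
  congr (_ - _); rewrite -mulr_sumr /collisions [in LHS]exchange_big mulr_sumr mulr_sumr.
  apply: eq_bigr => h _; rewrite [in LHS]exchange_big mulr_sumr mulr_sumr.
  apply: eq_bigr => h' _ /=; rewrite mulr_sumr.
  rewrite (eq_bigr _ (fun m _ => patE m h h')).
  rewrite sum_coprime_prod ?index_enum_uniq //.
  - rewrite /N natr_prod -big_split; apply: eq_bigr => i _ /=.
    rewrite big_split /= big_const_nat iter_addr_0 subn0 mulrDr mulr1; congr (_ + _).
    by rewrite /gam mulrC divfK // pnatr_eq0 -lt0n.
  - by move=> i j _ _; apply: cP.
  - by move=> i n; rewrite /chi (addnAC n _ h) (addnAC n _ h') !XP.
have sumD_le : \sum_(0 <= m < N) D m <= N%:R * (2 ^+ k * (k%:R * (delta * H%:R ^+ 2))).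
  rewrite sumD ler_wpM2l //; apply: (le_trans (y := \sum_(0 <= h < H) \sum_(0 <= h' < H)
      2 ^+ k * \sum_i `|gam i h h'|)).
    apply: ler_sum => h _; apply: ler_sum => h' _; rewrite lerBlDl.
    have := prod1D_le (index_enum 'I_k) (fun i => gam1 i h h').
    by rewrite -sum1_size sum1_card card_ord.
  under eq_bigr do rewrite -mulr_sumr.
  rewrite -mulr_sumr ler_wpM2l ?exprn_ge0 //.
  under eq_bigr do rewrite exchange_big.
  rewrite exchange_big /=.
  have -> : k%:R * (delta * H%:R ^+ 2) = \sum_(i < k) delta * H%:R ^+ 2.
    by rewrite sumr_const card_ord mulr_natl.
  by apply: ler_sum => i _; apply: mean.
(* Since 2H <= P i, at least half of each period leaves room for H, hence at least a fraction 2^(-k)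
   of all m. *)
have goodN : N%:R <= 2 ^+ k * \sum_(0 <= m < N) (good m)%:R :> R.
  have goodE m : (good m)%:R = \prod_i (m %% P i + H <= P i)%N%:R :> R.
    rewrite /good; case: forallP => [g|g].
      by rewrite big1 // => i _; rewrite g.
    case: (boolP [exists i, ~~ (m %% P i + H <= P i)%N]) => [/existsP[i /negbTE gi]|].
      by rewrite (bigD1 i) //= gi mul0r.
    by rewrite negb_exists => /forallP g'; case: g => i; have := g' i; rewrite negbK.
  rewrite (eq_bigr _ (fun m _ => goodE m)).
  rewrite sum_coprime_prod ?index_enum_uniq //; last 2 first.
  - by move=> i j _ _; apply: cP.
  - by move=> i n; rewrite modnDr.
  have -> : 2 ^+ k = \prod_(i < k) 2 :> R by rewrite prodr_const card_ord.
  rewrite -big_split /N natr_prod /=; apply: ler_prod => i _; rewrite ler0n /=.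
  (* [H.-1] gives the strict inequality that [sum_threshold] expects. *)
  rewrite (eq_big_nat _ _ (F2 := fun m => if (m + H.-1 < P i)%N then 1 else 0)).
    rewrite sum_threshold; last by have := HP i; lia.
    rewrite mul0rn addr0 -natrM ler_nat.
    by have := HP i; lia.
  move=> m /andP[_ mP]; rewrite modn_small //.
  have -> : (m + H.-1 < P i)%N = (m + H <= P i)%N by lia.
  by case: leqP.
(* 8^k is three factors 2^k: the density of good m, the number of vectors in [goodD], and the loss
   in [prod1D_le]. *)
have : N%:R * H%:R ^+ 2 <= 8 ^+ k * k%:R * delta * (N%:R * H%:R ^+ 2).
  have K0 : 0 <= 2 ^+ k :> R by rewrite exprn_ge0.
  have h2 : 0 <= H%:R ^+ 2 :> R by rewrite exprn_ge0.
  apply: le_trans (ler_wpM2r h2 goodN) _; rewrite -[leLHS]mulrA.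
  have -> : 8 ^+ k * k%:R * delta * (N%:R * H%:R ^+ 2)
     = 2 ^+ k * (2 ^+ k * (N%:R * (2 ^+ k * (k%:R * (delta * H%:R ^+ 2))))).
    have -> : 8 = 2 * 2 * 2 :> R by ring.
    by rewrite !exprMn; ring.
  rewrite ler_wpM2l // mulr_suml; apply: le_trans (ler_wpM2l K0 sumD_le).
  rewrite -KE mulr_sumr; apply: ler_sum_nat => m /andP[_ mN]; exact: goodD.
have NH : 0 < N%:R * H%:R ^+ 2 :> R by rewrite mulr_gt0 // exprn_gt0 // ltr0n.
by rewrite -{1}[N%:R * _]mul1r ler_pM2r // leNgt small.
Qed.
End SecondMoment.

(** * Legendre's formula and the size of the k-th odd prime *)

Section Primes.

Lemma e_p_div p n : prime p -> e_p p n = n %/ p + e_p p (n %/ p).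
Proof.
move=> pp; have p1 := prime_gt1 pp; rewrite /e_p !logn_fact //.
case: n => [|n]; first by rewrite div0n !big_geq.
rewrite [LHS]big_nat_recl // expn1; congr (_ + _).
have lt : (n.+1 %/ p).+1 <= n.+1 by rewrite ltn_Pdiv.
under eq_bigr do rewrite expnS divnMA.
rewrite (big_cat_nat _ lt) //= -[RHS]addn0; congr (_ + _).
rewrite big_nat big1 // => j /andP[hj _].
by rewrite divn_small // (leq_trans hj) // ltnW // ltn_expl.
Qed.

(** Two Legendre steps add n/p + n/p^2 (rounded down). As p is odd, n/p has the parity of n/p^2 plus
    the second digit, so only that digit survives modulo 2. *)
Lemma odd_e_p p T n : prime p -> odd p ->
  odd (e_p p n) = dpar p T.*2 false n (+) odd (e_p p (n %/ p ^ T.*2)).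
Proof.
move=> pp op; elim: T n => [|T IH] n; first by rewrite double0 expn0 divn1.
rewrite doubleS /= (e_p_div n pp) (e_p_div (n %/ p) pp) !oddD IH.
rewrite !expnS !divnMA {1}(divn_eq (n %/ p) p) oddD oddM op andbT.
by rewrite !addbA; congr (_ (+) _ (+) _); case: (odd _); case: (odd _).
Qed.

Lemma prime_next_prime m : prime (next_prime m).
Proof. by rewrite /next_prime; case: ex_minnP => p /andP[]. Qed.

Lemma ltn_next_prime m : m < next_prime m.
Proof. by rewrite /next_prime; case: ex_minnP => p /andP[]. Qed.

Lemma next_prime_min m p : m < p -> prime p -> next_prime m <= p.
Proof.
by move=> mp pp; rewrite /next_prime; case: ex_minnP => q _; apply; rewrite mp.
Qed.

Lemma prime_nth_prime i : prime (nth_prime i).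
Proof. by case: i => // i; apply: prime_next_prime. Qed.

Lemma ltn_nth_prime i j : i < j -> nth_prime i < nth_prime j.
Proof. by move: i j; apply: (homo_ltn ltn_trans) => i; apply: ltn_next_prime. Qed.

Lemma nth_prime_inj : injective nth_prime.
Proof.
move=> i j e; case: (ltngtP i j) => // /ltn_nth_prime; by rewrite e ltnn.
Qed.

Lemma odd_nth_prime i : 0 < i -> odd (nth_prime i).
Proof.
move=> i0; have [e|//] := even_prime (prime_nth_prime i).
by have := ltn_nth_prime i0; rewrite e.
Qed.

Lemma lt_nth_primeP k q : prime q -> q < nth_prime k -> exists2 j, j < k & q = nth_prime j.
Proof.
move=> pq; elim: k => [|k IH] /=; first by move=> lt; have := prime_gt1 pq; rewrite ltnNge -ltnS lt.
move=> lt; case: (ltngtP q (nth_prime k)) => [/IH[j jk ->]|h|->].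
- by exists j => //; apply: ltnW.
- by have := next_prime_min h pq; rewrite leqNgt lt.
- by exists k.
Qed.

Lemma logn_le_expn2 p n L : n <= 2 ^ L -> logn p n <= L.
Proof.
move=> nL; case: (posnP n) => [->|n0]; first by rewrite logn0.
case: (boolP (prime p)) => [pp|np]; last by rewrite lognE (negbTE np).
have h1 := dvdn_leq n0 (pfactor_dvdnn p n).
have h2 : 2 ^ logn p n <= p ^ logn p n 
  by case: (logn p n) => // e; rewrite leq_exp2r // prime_gt1.
by have := leq_trans h2 (leq_trans h1 nL); rewrite leq_exp2l.
Qed.

(* Numbers up to [2 ^ L] are determined by their exponent vectors. *)
Lemma smooth_count k L : 2 ^ L < nth_prime k -> 2 ^ L <= L.+1 ^ k.
Proof.
move=> hk.
pose f (n : 'I_(2 ^ L)) := [ffun j : 'I_k => inord (logn (nth_prime j) n.+1) : 'I_L.+1].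
suff /card_in_imset : {in predT &, injective f}.
  move=> E; have := max_card [set f x | x in predT].
  by rewrite E card_ord card_ffun !card_ord.
move=> m n _ _ /ffunP E; apply: val_inj; apply: succn_inj.
apply: eqn_from_log => // q.
case: (boolP (prime q)) => [pq|nq]; last first.
  by rewrite (lognE q m.+1) (lognE q n.+1) (negbTE nq).
case: (leqP q (2 ^ L)) => [qL|qL].
  have [j jk ->] := lt_nth_primeP pq (leq_ltn_trans qL hk).
  have := congr1 (@nat_of_ord _) (E (Ordinal jk)); rewrite !ffunE /=.
  by rewrite !inordK ?ltnS ?logn_le_expn2.
have z (x : 'I_(2 ^ L)) : logn q x.+1 = 0.
  rewrite lognE pq /=; case: ifP => // /dvdn_leq -/(_ isT) h.
  by have := leq_ltn_trans (leq_trans h (ltn_ord x)) qL; rewrite ltnn.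
by rewrite !z.
Qed.

(** Otherwise [smooth_count] with L = 4k^2 would give 16^k <= 4k^2 + 1. *)
Lemma nth_prime_le k : 0 < k -> nth_prime k <= 2 ^ (4 * k ^ 2).
Proof.
move=> k0; rewrite leqNgt; apply/negP => /smooth_count; apply/negP; rewrite -ltnNge.
have -> : 4 * k ^ 2 = 4 * k * k by rewrite -mulnA.
rewrite [2 ^ _]expnM ltn_exp2r // expnM.
elim: k k0 => // -[_ _ //|k] /(_ isT) IH _.
by rewrite expnS; move: (_ ^ k.+1) IH => y; lia.
Qed.
End Primes.

(** * Choice of parameters and realisation of every parity vector *)

Section Patterns.
Local Open Scope ring_scope.

(** (23/27)^20 <= 1/24, so 20k digit pairs beat 8^k and leave 2k / 3^k < 1. *)
Lemma decay_small (R : realFieldType) k :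
  8 ^+ k * k%:R * (2 * (23 / 27) ^+ (20 * k)) < 1 :> R.
Proof.
have x5 : (23 / 27 : R) ^+ 5 <= 9 / 20 by rewrite !exprS expr0; lra.
have x20 : (23 / 27 : R) ^+ 20 <= 1 / 24.
  rewrite -[(_ : R) ^+ 20]/(_ ^+ (5 * 4)) exprM.
  have n1 : 0 <= (23 / 27 : R) ^+ 5 by rewrite exprn_ge0 //; lra.
  apply: (le_trans (y := (9 / 20) ^+ 4)); first by rewrite lerXn2r // nnegrE; lra.
  by rewrite !exprS expr0; lra.
have h : (8 * (23 / 27) ^+ 20) ^+ k <= (1 / 3) ^+ k :> R.
  have n1 : 0 <= (23 / 27 : R) ^+ 20 by rewrite exprn_ge0 //; lra.
  by apply: lerXn2r; rewrite ?nnegrE; lra.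
have -> : 8 ^+ k * k%:R * (2 * (23 / 27) ^+ (20 * k))
   = 2 * k%:R * (8 * (23 / 27) ^+ 20) ^+ k :> R by
  rewrite exprM [(8 * _) ^+ k]exprMn; move: (_ ^+ k) (_ ^+ k) (k%:R : R) => x y z; ring.
apply: (le_lt_trans (ler_wpM2l _ h)); first by rewrite mulr_ge0.
rewrite expr_div_n expr1n mul1r ltr_pdivrMr ?exprn_gt0 // mul1r -natrM -natrX ltr_nat.
by elim: k {h} => // k IH; rewrite expnS; lia.
Qed.

Lemma parity_patterns k b (p : 'I_k -> nat) (eps : 'I_k -> bool) : (0 < k)%N ->
  (forall i, prime (p i)) -> (forall i, odd (p i)) -> injective p ->
  (forall i, p i <= 2 ^ b)%N ->
  exists n, [/\ (0 < n)%N, (n <= 2 ^ (1 + 40 * b * k ^ 2 * (1 + b * k)))%N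
    & forall i, odd (e_p (p i) n) = eps i].
Proof.
move=> k0 pp op pinj pb.
have p2 i : (2 < p i)%N by rewrite odd_prime_gt2.
have p0 i : (0 < p i)%N := prime_gt0 (pp i).
(* [t] rounds suffice by [decay_small]. As H <= 2^(2u), taking L = 2t + 2u digits ensures 2H <= 2^L
   <= P i. *)
pose t := (20 * k)%N; pose u := (b * k * t)%N; pose L := (t + u).*2.
(* A common multiple of all (p i ^ 2) ^ t, so one range of h suits every prime. *)
pose H := ((\prod_i p i ^ 2) ^ t)%N; pose P i := (p i ^ L)%N.
have t0 : (0 < t)%N by rewrite muln_gt0.
have H0 : (0 < H)%N by rewrite expn_gt0 prodn_gt0 // => i; rewrite expn_gt0 p0.
have prod_le (F : 'I_k -> nat) c :
    (forall i, F i <= 2 ^ c)%N -> (\prod_i F i <= 2 ^ (c * k))%N.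
  move=> Fc; rewrite expnM -[X in (_ ^ X)%N](card_ord k) -prod_nat_const.
  exact: leq_prod.
have Hb : (H <= 2 ^ (2 * u))%N.
  have -> : (2 * u = b * 2 * k * t)%N by rewrite /u; lia.
  rewrite [X in (_ <= X)%N]expnM leq_exp2r ?muln_gt0 //.
  by apply: prod_le => i; rewrite expnM leq_exp2r.
have HP i : (2 * H <= P i)%N.
  apply: (leq_trans (n := (2 ^ (2 * u).+1)%N)); first by rewrite expnS leq_mul2l Hb orbT.
  apply: (leq_trans (n := (2 ^ L)%N)).
    by rewrite leq_exp2l // /L; lia.
  by rewrite leq_exp2r ?(ltnW (p2 i)) // /L; lia.
have cP i j : i != j -> coprime (P i) (P j).
  move=> ij; rewrite /P coprimeXl // coprimeXr // prime_coprime // dvdn_prime2 //.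
  by apply: contra ij => /eqP/pinj->.
have XP i n : dpar (p i) L false (n + P i) = dpar (p i) L false n.
  by rewrite dpar_periodic.
have mean i : \sum_(0 <= h < H) \sum_(0 <= h' < H)
     `|(\sum_(0 <= m < P i) (-1) ^+ dpar (p i) L false (m + h)%N
          * (-1) ^+ dpar (p i) L false (m + h')%N) / (P i)%:R|
     <= 2 * (23 / 27) ^+ t * H%:R ^+ 2 :> rat.
  pose s := ((\prod_(j | j != i) p j ^ 2) ^ t)%N.
  have HE : H = (s * (p i ^ 2) ^ t)%N by rewrite /H (bigD1 i) //= expnMn mulnC.
  have := corr_mean rat t u.*2 s (op i) (p2 i).
  by rewrite /= -HE /dsign -doubleD.
have [m [mN good cover]] := patterns_covered H0 HP cP XP mean (decay_small rat k).
(* The digits beyond the first L depend on m alone, as adding h does not carry into them; their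
   parity is moved into the target. *)
have [h hH E] := cover (fun i => eps i (+) odd (e_p (p i) (m %/ P i))).
have En i : odd (e_p (p i) (m + h)) = eps i.
  rewrite (odd_e_p (t + u) _ (pp i) (op i)) E -addbA.
  have -> : ((m + h) %/ p i ^ (t + u).*2 = m %/ P i)%N.
    have lt : (m %% P i + h < P i)%N by rewrite (leq_trans _ (good i)) // ltn_add2l.
    rewrite -/(P i) [in LHS](divn_eq m (P i)) -addnA divnMDl ?expn_gt0 ?p0 //.
    by rewrite (divn_small lt) addn0.
  by rewrite addbb addbF.
have HN : (H <= \prod_i P i)%N.
  rewrite (bigD1 (Ordinal k0)) //= (leq_trans _ (leq_pmulr _ _)) //.
    by have := HP (Ordinal k0); lia.
  by rewrite prodn_gt0 // => i; rewrite expn_gt0 p0.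
have NE : (\prod_i P i <= 2 ^ (40 * b * k ^ 2 * (1 + b * k)))%N.
  have -> : (40 * b * k ^ 2 * (1 + b * k) = b * L * k)%N by rewrite /L /u /t; lia.
  by apply: prod_le => i; rewrite /P expnM leq_exp2r // /L; lia.
(* m + h may be 0; since 0! = 1!, replacing it by 1 keeps all exponents. *)
exists (maxn 1 (m + h)); split; first by rewrite leq_max.
- rewrite geq_max expn_gt0 /= add1n expnS.
  have lt : (m + h <= \prod_i P i + \prod_i P i)%N.
    by apply: leq_add; [apply: ltnW|apply: leq_trans HN; apply: ltnW].
  by move: NE lt; move: (2 ^ _)%N => ?; lia.
- move=> i; rewrite -En; case: (m + h)%N => [|n]; last by rewrite (maxn_idPr _).
  by rewrite /e_p fact0 maxn0 factS fact0.
Qed.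
End Patterns.

Lemma parity_prefix : exists C : nat, forall (eps : nat -> bool) (k : nat),
  exists n, [/\ 0 < n, n <= 2 ^ (C * k.+1 ^ 7)
    & forall i, 1 <= i <= k -> odd (e_p (nth_prime i) n) = eps i].
Proof.
(* With x the number of primes, 1 + 160 x^4 (1 + 4x^3) <= 1 + 800 (x + 1)^7 <= 801 (x + 1)^7. The
   case of no primes is separate. *)
exists 801 => eps [|k]; first by exists 1; split=> // i; lia.
have [|i|i|i j|i|n [n0 nb E]] := @parity_patterns k.+1 (4 * k.+1 ^ 2)
  (fun i => nth_prime i.+1) (fun i => eps i.+1).
- by [].
- exact: prime_nth_prime.
- exact: odd_nth_prime.
- by move=> /nth_prime_inj[] /val_inj.
- apply: (leq_trans (n := nth_prime k.+1)); last exact: nth_prime_le.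
  by case: (ltngtP i.+1 k.+1) (ltn_ord i) => [/ltn_nth_prime/ltnW||->].
exists n; split=> //.
  apply: leq_trans nb _; rewrite leq_exp2l //.
  set x := k.+1; have h1 : 1 + 4 * x ^ 2 * x <= 5 * x.+1 ^ 3.
    by rewrite !expnS expn0; nia.
  have h2 : x ^ 4 <= x.+1 ^ 4 by rewrite leq_exp2r.
  have h3 : 0 < x.+1 ^ 7 by rewrite expn_gt0.
  have -> : 40 * (4 * x ^ 2) * x ^ 2 = 160 * x ^ 4 by rewrite (expnD x 2 2); lia.
  have := leq_mul h2 h1.
  have -> : x.+1 ^ 4 * (5 * x.+1 ^ 3) = 5 * x.+1 ^ 7 by rewrite (expnD _ 4 3); lia.
  by move: (x ^ 4) (1 + _) h3 => A B; nia.
by case=> // i /andP[_ ik]; apply: (E (Ordinal ik)).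
Qed.

(* [ssrint] has rebound the key [%Z] to [int_scope]. *)
Delimit Scope Z_scope with Z.

Theorem theorem2 :
  exists c1 : R, Rlt 0 c1 /\
    forall eps : nat -> bool,
      exists X : R, forall x : R, Rle X x ->
        exists n : nat, (0 < n)%N /\ Rlt (INR n) x /\
          forall i : nat, (1 <= i)%N -> (Z.of_nat i <= kfun c1 x)%Z ->
            odd (e_p (nth_prime i) n) = eps i.
Proof.
have [C prefix] := parity_prefix; have [X small] := kfun_size_bound C.
(* The constant 1 works because [X] absorbs C; [X] does not depend on [eps]. *)
exists (IZR 1); split=> [|eps]; first exact: Rlt_0_1.
exists X => x Xx; have [n [n0 nb E]] := prefix eps (Z.to_nat (kfun (IZR 1) x)).
exists n; split=> //; split; first exact: small Xx _ nb.
by move=> i i1 iK; apply: E; lia.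
Qed.
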